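(* Let $\mathcal D\subset\mathbb R^d$ be a bounded domain, let $\boldsymbol x_1,\dots,\boldsymbol x_m\in\mathcal D$ be pairwise distinct, and let $p_1,\dots,p_l:\mathcal D\to\mathbb R$ be continuous functions, linearly independent on $\mathcal D$, with linear span $\mathcal P_l$. Assume that $1\in\mathcal P_l$ (the constant function), that $1\le l\le m$, that the $m\times l$ matrix $E=(p_j(\boldsymbol x_i))_{1\le i\le m,\,1\le j\le l}$ satisfies $\operatorname{rank}(E^t)=l$, and that the inverse weight function $w:[0,\infty)\to[0,\infty)$ is smooth. Let $\boldsymbol x\in\mathcal D$ be such that $w(\|\boldsymbol x-\boldsymbol x_i\|)>0$ for all $i=1,\dots,m$, and put $D=2\,\mathrm{diag}\big(w(\|\boldsymbol x-\boldsymbol x_1\|),\dots,w(\|\boldsymbol x-\boldsymbol x_m\|)\big)$. Let $$A_1=D^{-1}E\left(E^tD^{-1}E\right)^{-1}E^t,\qquad A_2=A_1-I .$$ Then the matrices $A_1D^{-1}$ and $A_2D^{-1}$ are symmetric.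
   Context: $\|\cdot\|$ is the Euclidean norm, $^t$ denotes transpose, and $I$ is the $m\times m$ identity matrix. The function $w$ comes from a weight function $W$, strictly positive on $(0,\infty)$, via $w(r)=1/W(r)$ if $r>0$, or if $r=0$ and $W(0)<\infty$; and $w(0)=0$ if $W(0)=\infty$. In particular $w(r)>0$ for $r>0$. Under the stated hypotheses $E^tD^{-1}E$ is non-singular, so $A_1$ is well defined. *)

(* Defs.v *)
From HB Require Import structures.
From mathcomp Require Import all_boot all_order all_algebra.
From mathcomp Require Import all_classical all_reals all_analysis.
Import Order.TTheory GRing.Theory Num.Theory.
Import numFieldNormedType.Exports.

Set Implicit Arguments.
Unset Strict Implicit.
Unset Printing Implicit Defensive.

Local Open Scope classical_set_scope.
Local Open Scope ring_scope.

(* The library norm [`|v|] on ['rV[R]_d] is the sup norm. It yields the same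
   open, connected and bounded sets as [enorm], but the weights need [enorm]. *)
Definition enorm (R : realType) (d : nat) (v : 'rV[R]_d) : R :=
  Num.sqrt (\sum_(k < d) v ord0 k ^+ 2).

Definition is_domain (R : realType) (d : nat) (Om : set 'rV[R]_d) : Prop :=
  [/\ Om !=set0, open Om & connected Om].

(* Functions on a set [A] are represented by total functions, about which
   nothing is assumed outside [A]. *)
Definition lin_indep_on (R : realType) (T : Type) (A : set T) (l : nat)
    (p : 'I_l -> T -> R) : Prop :=
  forall c : 'I_l -> R,
    (forall y, A y -> \sum_(j < l) c j * p j y = 0) -> forall j, c j = 0.

Definition lin_span_on (R : realType) (T : Type) (A : set T) (l : nat)
    (p : 'I_l -> T -> R) : set (T -> R) :=
  [set f | exists c : 'I_l -> R,
             forall y, A y -> f y = \sum_(j < l) c j * p j y].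

(* Infinitely differentiable on [A]; [g n] is the n-th derivative. The difference
   quotients stay inside [A], so derivatives are one-sided at endpoints of [A]. *)
Definition smooth_on (R : realType) (A : set R) (f : R -> R) : Prop :=
  exists g : nat -> R -> R,
    (forall r, A r -> g 0%N r = f r) /\
    (forall n r, A r ->
       (fun s => (g n s - g n r) / (s - r)) @ within A r^' --> g n.+1 r).

(* A weight is real-valued and positive on ]0, +oo[; [W 0] may be [+oo].
   [0 < W 0] says that [1 / W 0], when used, makes sense and is nonnegative. *)
Definition weight_function (R : realType) (W : R -> \bar R) : Prop :=
  (forall r : R, 0 < r -> (0 < W r < +oo)%E) /\ (0 < W 0%R)%E.

Definition inverse_weight (R : realType) (W : R -> \bar R) (r : R) : R :=
  if (0 < r) || ((r == 0) && (W 0%R < +oo)%E) then (fine (W r))^-1 else 0.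

Definition mls_E (R : realType) (d m l : nat) (xs : 'I_m -> 'rV[R]_d)
    (p : 'I_l -> 'rV[R]_d -> R) : 'M[R]_(m, l) :=
  \matrix_(i < m, j < l) p j (xs i).

Definition mls_D (R : realType) (d m : nat) (w : R -> R)
    (xs : 'I_m -> 'rV[R]_d) (x : 'rV[R]_d) : 'M[R]_m :=
  2 *: diag_mx (\row_(i < m) w (enorm (x - xs i))).

Definition mls_A1 (R : realType) (m l : nat) (D : 'M[R]_m) (E : 'M[R]_(m, l)) :
    'M[R]_m :=
  invmx D *m E *m invmx (E^T *m invmx D *m E) *m E^T.

Definition mls_A2 (R : realType) (m l : nat) (D : 'M[R]_m) (E : 'M[R]_(m, l)) :
    'M[R]_m :=
  mls_A1 D E - 1%:M.

(* Main.v *)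
Require Import Defs.
From HB Require Import structures.
From mathcomp Require Import all_boot all_order all_algebra.
From mathcomp Require Import all_classical all_reals all_analysis.
Import Order.TTheory GRing.Theory Num.Theory.
Import numFieldNormedType.Exports.
Local Open Scope classical_set_scope.
Local Open Scope ring_scope.

(** Since [D] is diagonal, [D^-1] is symmetric, and so are [E^T D^-1 E] and its inverse. Hence [A1
    D^-1 = D^-1 E (E^T D^-1 E)^-1 E^T D^-1] is a palindrome under transposition, and
    [A2 D^-1 = A1 D^-1 - D^-1] is a difference of symmetric matrices. *)

Lemma symmetricmxP (R : fieldType) (n : nat) (A : 'M[R]_n) :
  reflect (A^T = A) (A \is symmetricmx).
Proof.
(* [symmetricmx] is the hermitian predicate with sign [(-1) ^+ 0] and the identity as
   conjugation. *)
rewrite qualifE/= expr0 scale1r map_mx_id// eq_sym.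
exact: eqP.
Qed.

(* [invmx] of a singular matrix is the matrix itself, so [trmx_inv] holds
   unconditionally. *)
Lemma mls_A1_invmx_sym (R : realType) (m l : nat) (D : 'M[R]_m)
    (E : 'M[R]_(m, l)) :
  D^T = D -> (mls_A1 D E *m invmx D)^T = mls_A1 D E *m invmx D.
Proof.
move=> DT; rewrite /mls_A1 !(trmx_mul, trmx_inv, trmxK) DT.
(* The factors now agree in order; only the bracketing differs. *)
by rewrite !mulmxA.
Qed.

Theorem lemma2p1 (R : realType) (d m l : nat) (Om : set 'rV[R]_d)
    (xs : 'I_m -> 'rV[R]_d) (p : 'I_l -> 'rV[R]_d -> R)
    (W : R -> \bar R) (x : 'rV[R]_d)
    (Om_domain : is_domain Om) (Om_bounded : bounded_set Om)
    (xs_in : forall i, Om (xs i)) (xs_inj : injective xs)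
    (p_cont : forall j, {within Om, continuous (p j)})
    (p_indep : lin_indep_on Om p)
    (one_in_span : lin_span_on Om p (fun=> 1))
    (l_bounds : (1 <= l <= m)%N)
    (rankE : \rank (mls_E xs p)^T = l)
    (W_weight : weight_function W)
    (w_smooth : smooth_on `[0, +oo[ (inverse_weight W))
    (x_in : Om x)
    (w_pos : forall i, 0 < inverse_weight W (enorm (x - xs i))) :
  let E := mls_E xs p in
  let D := mls_D (inverse_weight W) xs x in
  (mls_A1 D E *m invmx D) \is symmetricmx /\
  (mls_A2 D E *m invmx D) \is symmetricmx.
Proof.
move=> E D.
have DT : D^T = D by rewrite /D /mls_D linearZ/= tr_diag_mx.
split; apply/symmetricmxP; first exact: mls_A1_invmx_sym.
rewrite /mls_A2 mulmxBl mul1mx linearB/=.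
by rewrite mls_A1_invmx_sym// trmx_inv DT.
Qed.
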